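(* Let $1<p\le q<\infty$, $1\le r,s\le\infty$, $\gamma\in\mathbb R$, and $w_\gamma(x)=|x|^\gamma$ on $\mathbb R^d$. Then $w_\gamma\in A_{(p,r),(q,s)}$ if and only if both of the following conditions hold: (a) $\gamma>-\frac dq$, or $\gamma=-\frac dq$ and $s=\infty$; (b) $\gamma<\frac d{p'}$, or $\gamma=\frac d{p'}$ and $r=1$.
   Context: For a measurable $f$ on $\mathbb R^d$ with decreasing rearrangement $f^*$, $\|f\|_{L^{a,b}}:=\big(\frac ba\int_0^\infty[t^{1/a}f^*(t)]^b\frac{dt}t\big)^{1/b}$ for $0<a,b<\infty$, and $\|f\|_{L^{a,\infty}}:=\sup_{t>0}t^{1/a}f^*(t)$. For a cube $Q$ (sides parallel to the axes), $\|h\|_{L^{a,b}(Q)}:=|Q|^{-1/a}\|h\mathbf 1_Q\|_{L^{a,b}}$. Primes denote conjugate exponents, $1'=\infty$, $\infty'=1$. An a.e. positive and finite measurable function (weight) $w$ on $\mathbb R^d$ belongs to $A_{(p,r),(q,s)}$ if $$\sup_Q\|w\|_{L^{q,s}(Q)}\,\|w^{-1}\|_{L^{p',r'}(Q)}<\infty,$$ the supremum being over all cubes $Q\subset\mathbb R^d$. *)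

(* Defs.v *)
From HB Require Import structures.
From mathcomp Require Import all_boot all_order all_algebra.
From mathcomp Require Import all_classical all_reals all_analysis.
From mathcomp Require Import measurable_realfun.

Set Implicit Arguments.
Unset Strict Implicit.
Unset Printing Implicit Defensive.
Import Order.TTheory GRing.Theory Num.Theory.
Import numFieldNormedType.Exports.

Local Open Scope classical_set_scope.
Local Open Scope ring_scope.

(* R^d is represented by d.-tuple R, which carries the product (Borel)
   sigma-algebra; its Lebesgue measure is built by iterated products. *)
Section lebesgue_measure_step.
Context {R : realType} {n : nat}.

Definition tuple_cons (z : measurableTypeR R * n.-tuple R) : n.+1.-tuple R :=
  [tuple of z.1 :: z.2].

Lemma measurable_tuple_cons : measurable_fun setT tuple_cons.
Proof. exact: measurable_cons. Qed.

Variable mu : {sigma_finite_measure set (n.-tuple R) -> \bar R}.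

Definition tuple_cons_measure : set (n.+1.-tuple R) -> \bar R :=
  pushforward (@lebesgue_measure R \x mu)%E tuple_cons.

Let nu : {measure set (n.+1.-tuple R) -> \bar R} :=
  measure_function_pushforward__canonical__measure_function_Measure
    (@lebesgue_measure R \x mu)%E measurable_tuple_cons.

Let nu0 : tuple_cons_measure set0 = 0%E.
Proof. exact: (measure0 nu). Qed.

Let nu_ge0 A : (0 <= tuple_cons_measure A)%E.
Proof. exact: (measure_ge0 nu). Qed.

Let nu_sigma_additive : semi_sigma_additive tuple_cons_measure.
Proof. exact: (@measure_semi_sigma_additive _ _ _ nu). Qed.

HB.instance Definition _ := isMeasure.Build _ _ _ tuple_cons_measure
  nu0 nu_ge0 nu_sigma_additive.

Let nu_sigma_finite : sigma_finite setT tuple_cons_measure.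
Proof.
have /sigma_finiteP[F [FT ndF mF]] := sigma_finiteT (@lebesgue_measure R).
have /sigma_finiteP[G [GT ndG mG]] := sigma_finiteT mu.
pose tl (t : n.+1.-tuple R) : n.-tuple R := [tuple of behead t].
pose hd (t : n.+1.-tuple R) : measurableTypeR R := tnth t ord0.
exists (fun k => hd @^-1` F k `&` tl @^-1` G k).
  apply/esym/seteqP; split => // t _.
  have [i _ Fi] : (\bigcup_k F k) (hd t) by rewrite -FT.
  have [j _ Gj] : (\bigcup_k G k) (tl t) by rewrite -GT.
  exists (maxn i j) => //; split.
  - by move/subsetPset : (ndF _ _ (leq_maxl i j)); apply.
  - by move/subsetPset : (ndG _ _ (leq_maxr i j)); apply.
move=> k; have [mFk Fkoo] := mF k; have [mGk Gkoo] := mG k; split.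
  apply: measurableI.
  - rewrite -[X in measurable X]setTI.
    exact: (measurable_tnth ord0 measurableT mFk).
  - rewrite -[X in measurable X]setTI.
    exact: (measurable_behead measurableT mGk).
rewrite /tuple_cons_measure /pushforward.
rewrite (_ : _ @^-1` _ = F k `*` G k).
  by rewrite product_measure1E// lte_mul_pinfty// ge0_fin_numE.
apply/seteqP; split => -[x t] /= [].
- move=> Fx Gt; split; first by move: Fx; rewrite /hd tnth0.
  by move: Gt; rewrite (_ : tl _ = t)//; apply/val_inj.
- move=> Fx Gt; split; first by rewrite /= /hd tnth0.
  by rewrite /= (_ : tl _ = t)//; apply/val_inj.
Qed.

HB.instance Definition _ := @Measure_isSigmaFinite.Build _ _ _
  tuple_cons_measure nu_sigma_finite.

End lebesgue_measure_step.

Fixpoint borel_lebesgue (R : realType) (d : nat) :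
    {sigma_finite_measure set (d.-tuple R) -> \bar R} :=
  match d with
  | 0 => \d_[tuple]
  | d'.+1 => tuple_cons_measure (borel_lebesgue R d')
  end.

Lemma borel_lebesgue_box (R : realType) (d : nat) (A : 'I_d -> set R) :
  (forall i, measurable (A i)) ->
  borel_lebesgue R d [set x | forall i, A i (tnth x i)] =
  (\prod_(i < d) lebesgue_measure (A i))%E.
Proof.
elim: d A => [|d IH] A mA.
  rewrite big_ord0 /= diracE mem_set//=; by case.
rewrite big_ord_recl /= /tuple_cons_measure /pushforward.
rewrite (_ : _ @^-1` _ = A ord0 `*`
    [set x : d.-tuple R | forall i, A (lift ord0 i) (tnth x i)]); last first.
  apply/seteqP; split => -[x t] /=.
    move=> H; split; first by have := H ord0; rewrite tnth0.
    by move=> i; have := H (lift ord0 i); rewrite tnthS.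
  move=> [Ax At] i; have [j ->|->] := unliftP ord0 i; first by rewrite tnthS.
  by rewrite tnth0.
rewrite product_measure1E.
- by congr mule; exact: IH.
- exact: mA.
have -> : [set x : d.-tuple R | forall i, A (lift ord0 i) (tnth x i)] =
    \bigcap_(i in [set: 'I_d]) ((fun x : d.-tuple R => tnth x i)
      @^-1` A (lift ord0 i)).
  by apply/seteqP; split => [x H i _|x H i]; [exact: H|exact: H i I].
apply: fin_bigcap_measurable => [|i _]; first exact: finite_finset.
by rewrite -[X in measurable X]setTI; apply: measurable_tnth => //; exact: mA.
Qed.

(* The Caratheodory sets of the outer measure generated by the Borel measure
   are the Lebesgue measurable subsets of R^d. *)
Definition Rd (R : realType) (d : nat) : measurableType _ :=
  caratheodory_type (borel_lebesgue R d)^*%mu.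

Definition lebesgue_Rd (R : realType) (d : nat) :
    {measure set (Rd R d) -> \bar R} :=
  @completed_measure_extension _ _ _ (borel_lebesgue R d).

Section lorentz.
Context {R : realType} {d : nat}.
Local Open Scope ereal_scope.

Definition decreasing_rearrangement (f : Rd R d -> \bar R) (t : R) : \bar R :=
  ereal_inf [set l%:E | l in [set l : R | (0 <= l)%R /\
    lebesgue_Rd R d [set x | l%:E < `|f x|] <= t%:E]].

Definition lorentz_norm (a : R) (b : \bar R) (f : Rd R d -> \bar R) : \bar R :=
  match b with
  | b%:E => ((b / a)%:E *
      \int[lebesgue_measure]_(t in `]0%R, +oo[)
        (((t `^ a^-1)%:E * decreasing_rearrangement f t) `^ b * t^-1%:E)) `^ b^-1
  | +oo => ereal_sup [set (t `^ a^-1)%:E * decreasing_rearrangement f t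
                     | t in [set t : R | (0 < t)%R]]
  | -oo => 0 (* junk value *)
  end.

Definition is_cube (Q : set (Rd R d)) : Prop :=
  exists (c : d.-tuple R) (l : R), (0 < l)%R /\
    Q = [set x | forall i, (tnth c i <= tnth x i <= tnth c i + l)%R].

Definition lorentz_norm_on (a : R) (b : \bar R) (Q : set (Rd R d))
    (h : Rd R d -> \bar R) : \bar R :=
  lebesgue_Rd R d Q `^ (- a^-1) *
  lorentz_norm a b (fun x => h x * (\1_Q x)%:E).

Definition weight (w : Rd R d -> \bar R) : Prop :=
  measurable_fun setT w /\ {ae lebesgue_Rd R d, forall x, 0 < w x < +oo}.

(* A_{(p,r),(q,s)} for 1 < p < +oo: the conjugate exponent p' is then a real
   number, so that fine is harmless. *)
Definition A_class (p : R) (r : \bar R) (q : R) (s : \bar R)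
    (w : Rd R d -> \bar R) : Prop :=
  weight w /\
  ereal_sup [set lorentz_norm_on q s Q w *
      lorentz_norm_on (fine (hoelder_conjugate p%:E)) (hoelder_conjugate r) Q
        (fun x => (w x)^-1)
    | Q in is_cube] < +oo.

Definition euclidean_norm (x : Rd R d) : R :=
  Num.sqrt (\sum_(i < d) tnth x i ^+ 2).

(* By the convention for `^, the value at the origin is 0 if gamma != 0; this
   only concerns a null set (when 0 < d). *)
Definition power_weight (gamma : R) (x : Rd R d) : \bar R :=
  (euclidean_norm x `^ gamma)%:E.

End lorentz.

(* Main.v *)
(* For alpha <= 0 the rearrangement of |x|^alpha restricted to any cube of side l
   is at most a constant times t^(alpha/d) and vanishes for t >= l^d, while on a
   cube with a vertex at the origin it is also at least a constant times
   t^(alpha/d) for small t. Hence the L^(a,b) norm on a cube at the origin is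
   finite exactly when t^(b(1/a + alpha/d) - 1) is integrable at 0 (when
   t^(1/a + alpha/d) is bounded at 0 if b = oo), and then the normalized norm
   over every cube is O(l^alpha). Conditions (a) and (b) are these criteria for w
   and 1/w, only one of which is singular. Conversely, over a cube at distance
   O(l) from the origin the singular factor is O(l^alpha) and the other is
   O(l^(-alpha)), while over a cube farther away both are controlled by the
   supremum and |x| is essentially constant. *)
Require Import Defs.
From mathcomp Require Import all_boot all_order all_algebra.
From mathcomp Require Import all_classical all_reals all_analysis.
From mathcomp Require Import measurable_realfun.
From mathcomp Require Import lra ring.
Import Order.TTheory GRing.Theory Num.Theory.
Import numFieldNormedType.Exports.
Local Open Scope classical_set_scope.
Local Open Scope ring_scope.

(* Integrals of nonnegative functions are suprema over simple functions, so
   monotonicity needs no measurability. *)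
Lemma ge0_le_integral_nonmeasurable (d : measure_display)
    (T : measurableType d) (R : realType) (mu : {measure set T -> \bar R})
    (D : set T) (f g : T -> \bar R) :
  (forall x, D x -> (0 <= f x)%E) -> (forall x, D x -> (f x <= g x)%E) ->
  (\int[mu]_(x in D) f x <= \int[mu]_(x in D) g x)%E.
Proof.
move=> f0 fg; rewrite !ge0_integralE//; last first.
  by move=> x Dx; exact: le_trans (f0 x Dx) (fg x Dx).
apply: ereal_sup_le => _ [h /= hf <-]; exists h => // x.
by apply: le_trans (hf x) _; exact: lee_restrict.
Qed.

Lemma ge0_subset_integral_nonmeasurable (d : measure_display)
    (T : measurableType d) (R : realType) (mu : {measure set T -> \bar R})
    (A B : set T) (f : T -> \bar R) :
  A `<=` B -> (forall x, B x -> (0 <= f x)%E) ->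
  (\int[mu]_(x in A) f x <= \int[mu]_(x in B) f x)%E.
Proof.
move=> AB f0; rewrite (integral_mkcond A) (integral_mkcond B).
apply: ge0_le_integral_nonmeasurable => x _.
  by apply: erestrict_ge0 => y /AB; exact: f0.
exact: restrict_lee.
Qed.

(** * Integrals of powers near zero *)

Section integrals.
Context {R : realType}.
Local Notation mu := (@lebesgue_measure R).

Lemma integral_powR_itvcc (k e T : R) : k != 0 -> 0 < e -> e < T ->
  (\int[mu]_(t in `[e, T]) (t `^ (k - 1))%:E = (T `^ k / k - e `^ k / k)%:E)%E.
Proof.
move=> k0 e0 eT.
have dF (x : R) : 0 < x ->
    is_derive x 1 (fun y => y `^ k / k) (x `^ (k - 1)).
  move=> x0; rewrite (_ : x `^ (k - 1) = k^-1 *: (k * x `^ (k - 1))); last first.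
    by rewrite scalerA mulVf// scale1r.
  have -> : (fun y : R => y `^ k / k) = k^-1 \*: (@powR R ^~ k).
    by apply/funext => y /=; rewrite [LHS]mulrC.
  by apply: is_deriveZ; exact: is_derive1_powR.
have cF (x : R) : 0 < x -> {for x, continuous (fun y => y `^ k / k)}.
  move=> x0; apply: differentiable_continuous.
  by apply/derivable1_diffP; apply: (@ex_derive _ _ _ _ _ _ _ (dF _ x0)).
rewrite (@continuous_FTC2 _ _ (fun y => y `^ k / k))//.
- apply: derivable_within_continuous => x; rewrite in_itv/= => /andP[ex _].
  by apply: derivable_powR; rewrite in_itv/= andbT (lt_le_trans e0).
- split.
  + move=> x; rewrite in_itv/= => /andP[ex _].
    by apply: (@ex_derive _ _ _ _ _ _ _ (dF _ (lt_trans e0 ex))).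
  + by apply: cvg_at_right_filter; exact: cF.
  + by apply: cvg_at_left_filter; apply: cF; exact: lt_trans eT.
- move=> x; rewrite in_itv/= => /andP[ex _].
  rewrite derive1E.
  by apply: (@derive_val _ _ _ _ _ _ _ (dF _ (lt_trans e0 ex))).
Qed.

(** Monotone convergence along closed intervals exhausting []0, T]]: on each of them the primitive
    gives [T ^ k / k] minus a nonnegative boundary term, which is dropped. *)
Lemma integral_powR_itvoc_le (k T : R) : 0 < k -> 0 < T ->
  (\int[mu]_(t in `]0%R, T]) (t `^ (k - 1))%:E <= (T `^ k / k)%:E)%E.
Proof.
move=> k0 T0.
(* With [n.+2] the left end is strictly below [T] already at [n = 0]. *)
pose F (n : nat) : set R := `[T / n.+2%:R, T]%classic.
have FU : \bigcup_n F n = `]0, T]%classic.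
  apply/seteqP; split => [x [n _]|x]; rewrite /F/= !in_itv/= => /andP[xl xT].
    by rewrite xT (lt_le_trans _ xl)// divr_gt0.
  have := archi_boundP (ltW (divr_gt0 T0 xl)).
  set n := Num.bound _ => Tx; exists n => //.
  rewrite /F/= in_itv/= xT andbT ler_pdivrMr// mulrC -ler_pdivrMr//.
  by apply: le_trans (ltW Tx) _; rewrite ler_nat; do 2 apply: leqW.
rewrite -FU.
have cvgI : (\int[mu]_(t in F n) (t `^ (k - 1))%:E @[n --> \oo] -->
    \int[mu]_(t in \bigcup_n F n) (t `^ (k - 1))%:E)%E.
  apply: ge0_nondecreasing_set_cvg_integral.
  - move=> m n mn; apply/subsetPset => x; rewrite /F /= !in_itv/=.
    move=> /andP[xl ->]; rewrite andbT (le_trans _ xl)//.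
    by rewrite ler_pM2l// lef_pV2 ?posrE// ler_nat.
  - by move=> n; exact: measurable_itv.
  - move=> n; apply/measurable_EFinP; apply: measurable_funTS.
    exact: measurable_powR.
  - by move=> n x _; rewrite lee_fin powR_ge0.
rewrite -(cvg_lim _ cvgI)//.
apply: lime_le; first by apply/cvg_ex; eexists; exact: cvgI.
apply: nearW => n; rewrite /F.
rewrite integral_powR_itvcc ?gt_eqF ?divr_gt0//; last first.
  by rewrite ltr_pdivrMr// ltr_pMr// ltr1n.
by rewrite lee_fin gerBl divr_ge0 ?powR_ge0// ltW.
Qed.

Lemma integral_inv_itvoo (T : R) : 0 < T ->
  (\int[mu]_(t in `]0%R, T[) (t^-1)%:E = +oo)%E.
Proof.
move=> T0; apply/eqyP => A A0;
have T2 : 0 < T / 2 by rewrite divr_gt0.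
(* Chosen so that [ln (T / 2) - ln e = A]; halving [T] keeps the closed interval inside the open
   one. *)
pose e := T / 2 * expR (- A).
have e0 : 0 < e by rewrite mulr_gt0// expR_gt0.
have eT : e < T / 2.
  by rewrite /e gtr_pMr// -expR0 ltr_expR oppr_lt0.
have le_int : (\int[mu]_(t in `[e, (T / 2)%R]) (t^-1)%:E <=
    \int[mu]_(t in `]0%R, T[) (t^-1)%:E)%E.
  apply: ge0_subset_integral_nonmeasurable => [x|x]/=; rewrite !in_itv/=.
    move=> /andP[ex xT]; rewrite (lt_le_trans e0)//= (le_lt_trans xT)//.
    by rewrite ltr_pdivrMr// ltr_pMr// ltr1n.
  by move=> /andP[x0 _]; rewrite lee_fin invr_ge0 ltW.
apply: le_trans le_int.
rewrite (@continuous_FTC2 _ _ (@ln R))//.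
- rewrite -EFinB lee_fin /e.
  rewrite (@lnM _ (T / 2) (expR (- A))) ?posrE ?expR_gt0// expRK.
  by rewrite opprD opprK addrA subrr add0r.
- apply: continuous_in_subspaceT => x; rewrite inE/= in_itv/= => /andP[ex _].
  by apply: inv_continuous; rewrite gt_eqF// (lt_le_trans e0).
- split.
  + move=> x; rewrite in_itv/= => /andP[ex _].
    by apply: ex_derive; apply: is_derive1_ln; exact: lt_trans ex.
  + by apply: cvg_at_right_filter; exact: continuous_ln.
  + by apply: cvg_at_left_filter; apply: continuous_ln; exact: lt_trans eT.
- move=> x; rewrite in_itv/= => /andP[ex _].
  rewrite derive1E; apply: derive_val; apply: is_derive1_ln.
  exact: lt_trans ex.
Qed.

End integrals.

Lemma powRD_gt0 (R : realType) (x r s : R) : 0 < x ->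
  x `^ (r + s) = x `^ r * x `^ s.
Proof. by move=> x0; rewrite powRD// (gt_eqF x0) implybT. Qed.

(** * Lorentz norms of functions with power-like rearrangement *)

Section rearrangement.
Context {R : realType} {d : nat}.
Implicit Types (f : Rd R d -> \bar R) (a c e k l t K T : R) (b : \bar R).

Lemma decreasing_rearrangement_ge0 f t :
  (0 <= decreasing_rearrangement f t)%E.
Proof. by apply: le_ereal_inf_tmp => _ [l /= [l0 _] <-]; rewrite lee_fin. Qed.

Lemma decreasing_rearrangement_le f t l : 0 <= l ->
  (lebesgue_Rd R d [set x | l%:E < `|f x|] <= t%:E)%E ->
  (decreasing_rearrangement f t <= l%:E)%E.
Proof. by move=> l0 fl; apply: ereal_inf_lbound; exists l. Qed.

Lemma decreasing_rearrangement_ge f t l :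
  (forall l', 0 <= l' -> l' < l ->
    (t%:E < lebesgue_Rd R d [set x | l'%:E < `|f x|])%E) ->
  (l%:E <= decreasing_rearrangement f t)%E.
Proof.
move=> H; apply: le_ereal_inf_tmp => _ [l' /= [l'0 fl'] <-].
rewrite lee_fin leNgt; apply/negP => /(H _ l'0).
by rewrite ltNge fl'.
Qed.

Lemma powR_lorentz_integrand a e c (b t : R) : 0 < t -> 0 <= c ->
  ((t `^ a^-1 * (c * t `^ e)) `^ b * t^-1 =
  c `^ b * t `^ (b * (a^-1 + e) - 1))%R.
Proof.
move=> t0 c0; rewrite mulrCA -powRD_gt0//.
rewrite powRM ?powR_ge0// -powRrM (mulrC _ b) -mulrA; congr (_ * _).
by rewrite powRD_gt0// powRN powRr1// ltW.
Qed.

(** The criterion for a rearrangement behaving like [t ^ e] near 0 to have a finite L^(a,b) norm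
    there; with [e = alpha / d] it yields conditions (a) and (b). *)
Definition lorentz_admissible (a e : R) (b : \bar R) : Prop :=
  0 < a^-1 + e \/ a^-1 + e = 0 /\ b = +oo%E.

(** The constant is chosen before [K], [T] and [f], which later makes the bounds uniform over all
    cubes. For [b = +oo] the power [t ^ (1/a + e)] is nondecreasing, so its value at [T] bounds it;
    for finite [b] one integrates [t ^ (k - 1)] up to [T]. *)
Lemma lorentz_norm_upper a e b : 0 < a -> (1 <= b)%E ->
  lorentz_admissible a e b ->
  exists2 C, 0 <= C & forall K T f, 0 <= K -> 0 < T ->
    (forall t, 0 < t -> t < T ->
      (decreasing_rearrangement f t <= (K * t `^ e)%:E)%E) ->
    (forall t, T <= t -> (decreasing_rearrangement f t <= 0)%E) ->
    (lorentz_norm a b f <= (C * K * T `^ (a^-1 + e))%:E)%E.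
Proof.
move=> a0 b1 adm.
have f0 f t : (decreasing_rearrangement f t <= 0)%E ->
    decreasing_rearrangement f t = 0%E.
  by move=> h; apply/eqP; rewrite eq_le h decreasing_rearrangement_ge0.
case: b b1 adm => [b|_|//]; last first.
  move=> adm; exists 1 => // K T f K0 T0 fK fT /=.
  apply: ge_ereal_sup => _ [t /= t0 <-]; rewrite mul1r.
  have [tT|Tt] := ltP t T; last first.
    by rewrite f0 ?fT// mule0 lee_fin mulr_ge0// powR_ge0.
  apply: le_trans (lee_wpmul2l _ (fK t t0 tT)) _; first by rewrite lee_fin powR_ge0.
  rewrite -EFinM lee_fin mulrCA ler_wpM2l// -powRD_gt0//.
  have k0 : 0 <= a^-1 + e by case: adm => [/ltW//|[->]].
  by rewrite ge0_ler_powR// ?nnegrE ltW.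
rewrite lee_fin => b1 [k0|[_]//].
have b0 : 0 < b by rewrite (lt_le_trans ltr01).
pose k := b * (a^-1 + e); have kgt0 : 0 < k by rewrite mulr_gt0.
(* The factor [b / a] of the norm times the [1 / k] from integrating [t ^ (k - 1)], under the outer
   root. *)
exists ((b / a / k) `^ b^-1); first exact: powR_ge0.
move=> K T f K0 T0 fK fT /=.
have int_le : (\int[lebesgue_measure]_(t in `]0%R, +oo[)
    (((t `^ a^-1)%:E * decreasing_rearrangement f t) `^ b * t^-1%:E) <=
    (K `^ b * (T `^ k / k))%:E)%E.
  apply: (@le_trans _ _ (\int[lebesgue_measure]_(t in `]0%R, +oo[)
    (((fun u : R => (K `^ b)%:E * (u `^ (k - 1))%:E) \_ `]0%R, T]) t))%E).
    apply: ge0_le_integral_nonmeasurable => t /=; rewrite in_itv/= andbT => t0.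
      by rewrite mule_ge0 ?poweR_ge0// lee_fin invr_ge0 ltW.
    rewrite patchE; have [tT|Tt] := ltP t T; last first.
      (* Since [b] is nonzero, the [b]-th power of 0 is 0, and the integrand vanishes from [T]
         on. *)
      rewrite f0 ?fT// mule0 poweR0r ?gt_eqF// mul0e; case: ifP => // _.
      by rewrite -EFinM lee_fin mulr_ge0 ?powR_ge0.
    rewrite mem_set/=; last by rewrite in_itv/= t0 ltW.
    rewrite -EFinM -powR_lorentz_integrand// EFinM -(poweR_EFin _ b).
    apply: lee_wpmul2r; first by rewrite lee_fin invr_ge0 ltW.
    apply: gt0_ler_poweR; rewrite ?(ltW b0)//.
    - by rewrite in_itv/= leey andbT mule_ge0 ?decreasing_rearrangement_ge0// lee_fin powR_ge0.
    - by rewrite in_itv/= leey andbT lee_fin !mulr_ge0// powR_ge0.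
    - by rewrite EFinM lee_wpmul2l ?fK// lee_fin powR_ge0.
  rewrite -integral_mkcondr setIidr; last first.
    by move=> t /=; rewrite !in_itv/= => /andP[->].
  rewrite ge0_integralZl_EFin ?powR_ge0//; last 2 first.
  - by move=> t _; rewrite lee_fin powR_ge0.
  - by apply/measurable_EFinP; apply: measurable_funTS; exact: measurable_powR.
  by rewrite EFinM lee_wpmul2l ?integral_powR_itvoc_le// lee_fin powR_ge0.
apply: (@le_trans _ _ (((b / a)%:E * (K `^ b * (T `^ k / k))%:E) `^ b^-1)%E).
  have ba0 : (0 <= (b / a)%:E)%E by rewrite lee_fin divr_ge0// ltW.
  apply: gt0_ler_poweR; first by rewrite invr_ge0 ltW.
  - rewrite in_itv/= leey andbT mule_ge0// integral_ge0// => t /=.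
    by rewrite in_itv/= andbT => t0; rewrite mule_ge0 ?poweR_ge0// lee_fin invr_ge0 ltW.
  - by rewrite in_itv/= leey andbT mule_ge0// lee_fin !mulr_ge0 ?powR_ge0// invr_ge0 ltW.
  - exact: lee_wpmul2l.
rewrite -EFinM poweR_EFin lee_fin.
rewrite (_ : b / a * (_ * _) = b / a / k * (K `^ b * T `^ k)); last by ring.
have bak : 0 <= b / a / k by rewrite !divr_ge0// ltW.
rewrite (powRM _ bak (mulr_ge0 (powR_ge0 _ _) (powR_ge0 _ _))).
rewrite (@powRM _ (K `^ b)) ?powR_ge0//.
rewrite -!powRrM (mulfV (lt0r_neq0 b0)) powRr1//.
rewrite {1}/k [b * _ / b]mulrAC (mulfV (lt0r_neq0 b0)) mul1r.
by rewrite mulrA.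
Qed.

(** Positivity is recorded along with the criterion because finiteness of a product of two norms
    bounds each factor only when the other is nonzero. *)
Lemma lorentz_norm_lower a e b c f : 0 < a -> (1 <= b)%E -> 0 < c ->
  (forall t, 0 < t -> t < 1 ->
    ((c * t `^ e)%:E <= decreasing_rearrangement f t)%E) ->
  (0 < lorentz_norm a b f)%E /\
  ((lorentz_norm a b f < +oo)%E -> lorentz_admissible a e b).
Proof.
move=> a0 b1 c0 cf; rewrite /lorentz_admissible; set k := a^-1 + e.
case: b b1 => [b|_|//]; last first.
  have ub t : 0 < t -> t < 1 -> ((c * t `^ k)%:E <= lorentz_norm a +oo%E f)%E.
    move=> t0 t1; apply: le_ereal_sup_tmp.
    exists ((t `^ a^-1)%:E * decreasing_rearrangement f t)%E; first by exists t.
    apply: le_trans (lee_wpmul2l _ (cf t t0 t1)); last by rewrite lee_fin powR_ge0.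
    by rewrite -EFinM lee_fin mulrCA -powRD_gt0.
  split.
    apply: lt_le_trans (ub (2^-1) _ _); rewrite ?invr_gt0//; last by lra.
    by rewrite lte_fin mulr_gt0// powR_gt0// invr_gt0.
  move=> Noo; case: (ltgtP 0 k) => [|kn0|]; [by left| |by right].
  have Nfin : lorentz_norm a +oo%E f \is a fin_num.
    rewrite ge0_fin_numE//; apply: le_trans (ub (2^-1) _ _); last by lra.
      by rewrite lee_fin mulr_ge0 ?powR_ge0// ltW.
    by rewrite invr_gt0.
  pose N := fine (lorentz_norm a +oo%E f).
  (* For [k < 0] the point [t = y ^ (1/k)] lies in []0, 1[] since [y > 1], and there
     [c * t ^ k = c * y] exceeds the supposed supremum [N]. *)
  pose y := Num.max (N / c) 1 + 1.
  have y1 : 1 < y by rewrite /y ltrDr lt_max ltr01 orbT.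
  have y0 : 0 < y by rewrite (lt_trans ltr01).
  have t0 : 0 < y `^ k^-1 by rewrite powR_gt0.
  have t1 : y `^ k^-1 < 1.
    rewrite /powR gt_eqF// -expR0 ltr_expR.
    by rewrite pmulr_llt0 ?ln_gt0// invr_lt0.
  have := ub _ t0 t1; rewrite -(fineK Nfin) lee_fin -/N -powRrM mulVf ?lt_eqF//.
  rewrite powRr1 ?(ltW y0)// mulrC -ler_pdivlMr// leNgt.
  by rewrite /y ltr_pwDr// le_max lexx.
rewrite lee_fin => b1; have b0 : 0 < b by rewrite (lt_le_trans ltr01).
pose I : \bar R := (\int[lebesgue_measure]_(t in `]0%R, +oo[)
    (((t `^ a^-1)%:E * decreasing_rearrangement f t) `^ b * t^-1%:E))%E.
have NE : lorentz_norm a b%:E f = (((b / a)%:E * I) `^ b^-1)%E by [].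
have ba0 : (0 < (b / a)%:E)%E by rewrite lte_fin divr_gt0.
(* Any minorant [g] of the pure power bounds the integral below. It serves twice: on a compact
   interval for positivity, and with [1 / t] for divergence. *)
have int_ge (D : set R) (g : R -> R) : measurable D ->
    (forall t, D t -> 0 < t < 1) -> (forall t, 0 < t < 1 -> 0 <= g t) ->
    measurable_fun D g -> (forall t, D t -> g t <= t `^ (b * k - 1)) ->
    ((c `^ b)%:E * \int[lebesgue_measure]_(t in D) (g t)%:E <= I)%E.
  move=> mD D01 g0 mg gk.
  rewrite -ge0_integralZl_EFin ?powR_ge0//; last 2 first.
  - by move=> t /D01/g0; rewrite lee_fin.
  - exact/measurable_EFinP.
  apply: (@le_trans _ _ (\int[lebesgue_measure]_(t in D)
    (((t `^ a^-1)%:E * decreasing_rearrangement f t) `^ b * t^-1%:E))%E).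
    apply: ge0_le_integral_nonmeasurable => t Dt.
      by rewrite -EFinM lee_fin mulr_ge0 ?powR_ge0// g0// D01.
    have /andP[t0 t1] := D01 _ Dt.
    apply: (@le_trans _ _ (c `^ b * t `^ (b * k - 1))%:E).
      by rewrite -EFinM lee_fin ler_wpM2l ?powR_ge0// gk.
    rewrite -powR_lorentz_integrand ?(ltW c0)// EFinM -(poweR_EFin _ b).
    apply: lee_wpmul2r; first by rewrite lee_fin invr_ge0 ltW.
    apply: gt0_ler_poweR; rewrite ?(ltW b0)//.
    - by rewrite in_itv/= leey andbT lee_fin !mulr_ge0 ?powR_ge0// ltW.
    - by rewrite in_itv/= leey andbT mule_ge0 ?decreasing_rearrangement_ge0// lee_fin powR_ge0.
    - by rewrite EFinM lee_wpmul2l ?cf// lee_fin powR_ge0.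
  apply: ge0_subset_integral_nonmeasurable => t /=.
    by move=> /D01/andP[t0 _]; rewrite in_itv/= t0.
  by rewrite in_itv/= andbT => t0; rewrite mule_ge0 ?poweR_ge0// lee_fin invr_ge0 ltW.
split.
  rewrite NE poweR_gt0// mule_gt0//.
  (* As [n >= b * k] and [t < 1], [t ^ (n - 1)] is a minorant; its exponent stays clear of the
     logarithmic case [b * k = 0]. *)
  pose n : R := `|b * k| + 1; have n0 : 0 < n by rewrite ltr_wpDl.
  pose D : set R := `[4^-1, 2^-1]%classic.
  have h4 : 4^-1 < 2^-1 :> R by lra.
  have : ((c `^ b)%:E * \int[lebesgue_measure]_(t in D) (t `^ (n - 1))%:E <= I)%E.
    apply: int_ge => //; first exact: measurable_itv.
    - by move=> t; rewrite /D/= in_itv/= => /andP[? ?]; lra.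
    - by move=> t _; rewrite powR_ge0.
    - by apply: measurable_funTS; exact: measurable_powR.
    - move=> t; rewrite /D/= in_itv/= => /andP[? ?]; apply: ger_powR; first by lra.
      by rewrite lerD2r /n (le_trans (ler_norm _))// lerDl.
  move=> DI; apply: (lt_le_trans _ DI).
  rewrite /D (integral_powR_itvcc _ _ _ (lt0r_neq0 n0) _ h4)//.
  rewrite -EFinM lte_fin mulr_gt0 ?powR_gt0// -mulrBl divr_gt0// subr_gt0.
  by apply: gt0_ltr_powR => //; rewrite nnegrE; lra.
(* If [k <= 0], then [t ^ (b * k - 1) >= 1 / t] on []0, 1[], whose integral diverges. *)
rewrite NE => Noo; left; rewrite ltNge; apply/negP => kle0.
have Ioo : I = +oo%E.
  apply/eqP; rewrite -leye_eq.
  have : ((c `^ b)%:E * \int[lebesgue_measure]_(t in `]0%R, 1%R[) (t^-1)%:E <= I)%E.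
    apply: int_ge => //.
    - by move=> t /andP[t0 _]; rewrite invr_ge0 ltW.
    - apply: open_continuous_measurable_fun => // t; rewrite inE/= in_itv/=.
      by move=> /andP[t0 _]; apply: inv_continuous; rewrite gt_eqF.
    - move=> t /=; rewrite in_itv/= => /andP[t0 t1].
      rewrite -powR_inv1 ?(ltW t0)//; apply: ger_powR; first by rewrite t0 ltW.
      by rewrite gerDr pmulr_rle0.
  by rewrite integral_inv_itvoo// gt0_muley// lte_fin powR_gt0.
by move: Noo; rewrite Ioo gt0_muley// poweRyr ?ltxx// gt_eqF// invr_gt0.
Qed.

End rearrangement.

(** * Lebesgue measure of boxes and the Euclidean norm *)

Section euclidean_space.
Context {R : realType} {d : nat}.
Implicit Types (x : Rd R d) (c l : R).

(** The measure is an outer measure on all subsets, so level sets can be compared without checking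
    measurability. *)
Lemma lebesgue_Rd_subset (A B : set (Rd R d)) : A `<=` B ->
  (lebesgue_Rd R d A <= lebesgue_Rd R d B)%E.
Proof. exact: (le_mu_ext (borel_lebesgue R d)). Qed.

Lemma measurable_box (A : 'I_d -> set R) : (forall i, measurable (A i)) ->
  measurable ([set x | forall i, A i (tnth x i)] : set (d.-tuple R)).
Proof.
move=> mA.
have -> : [set x : d.-tuple R | forall i, A i (tnth x i)] =
    \bigcap_(i in [set: 'I_d]) ((fun x : d.-tuple R => tnth x i) @^-1` A i).
  by apply/seteqP; split => [x H i _|x H i]; [exact: H|exact: H i I].
apply: fin_bigcap_measurable => [|i _]; first exact: finite_finset.
by rewrite -[X in measurable X]setTI; apply: measurable_tnth => //; exact: mA.
Qed.

Lemma lebesgue_Rd_box (A : 'I_d -> set R) : (forall i, measurable (A i)) ->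
  lebesgue_Rd R d [set x | forall i, A i (tnth x i)] =
  (\prod_(i < d) lebesgue_measure (A i))%E.
Proof.
move=> mA; rewrite -borel_lebesgue_box//.
by apply: measurable_mu_extE; exact: measurable_box.
Qed.

(** The booleans select the endpoints: [true false] gives closed sides, [false false] sides open on
    the left. *)
Lemma lebesgue_Rd_itv_box (a b : bool) (u v : 'I_d -> R) (l : R) : 0 < l ->
  (forall i, v i = u i + l) ->
  lebesgue_Rd R d [set x | forall i,
    [set` Interval (BSide a (u i)) (BSide b (v i))] (tnth x i)] = (l ^+ d)%:E.
Proof.
move=> l0 uv.
rewrite (lebesgue_Rd_box (fun i => [set` Interval (BSide a (u i)) (BSide b (v i))]))//.
rewrite (eq_bigr (fun=> l%:E)); last first.
  move=> i _; rewrite lebesgue_measure_itv/= uv lte_fin ltrDl l0.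
  by rewrite -EFinB addrAC subrr add0r.
by rewrite prodEFin prodr_const card_ord.
Qed.

Lemma lebesgue_Rd_cube (c : d.-tuple R) l : 0 < l ->
  lebesgue_Rd R d [set x | forall i, tnth c i <= tnth x i <= tnth c i + l] =
  (l ^+ d)%:E.
Proof.
move=> l0; rewrite -(@lebesgue_Rd_itv_box true false (tnth c) _ l l0 (fun=> erefl)).
by congr (lebesgue_Rd R d _); apply/seteqP; split => x /= H i;
  have := H i; rewrite in_itv.
Qed.

Lemma euclidean_norm_ge0 x : 0 <= euclidean_norm x.
Proof. exact: sqrtr_ge0. Qed.

Lemma ler_coord_euclidean_norm x i : `|tnth x i| <= euclidean_norm x.
Proof.
rewrite -sqrtr_sqr ler_wsqrtr// (bigD1 i)//= lerDl.
by apply: sumr_ge0 => j _; rewrite sqr_ge0.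
Qed.

Lemma euclidean_norm_le x (M : R) : 0 <= M -> (forall i, `|tnth x i| <= M) ->
  euclidean_norm x <= d%:R * M.
Proof.
move=> M0 xM; rewrite -[leRHS]ger0_norm ?mulr_ge0// -sqrtr_sqr ler_wsqrtr//.
apply: (@le_trans _ _ (\sum_(i < d) M ^+ 2)).
  by apply: ler_sum => i _; rewrite -real_normK ?num_real// lerXn2r ?nnegrE.
rewrite sumr_const card_ord -[leLHS]mulr_natl exprMn ler_wpM2r ?sqr_ge0//.
by rewrite -natrX ler_nat; case: d => // n; rewrite leq_pmulr.
Qed.

Lemma euclidean_norm_origin_null : (0 < d)%N ->
  lebesgue_Rd R d [set x | euclidean_norm x = 0] = 0%E.
Proof.
move=> d0; apply/eqP; rewrite eq_le measure_ge0 andbT.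
apply: (@le_trans _ _
  (lebesgue_Rd R d [set x | forall i, [set 0%R] (tnth x i)])).
  apply: lebesgue_Rd_subset => x /= x0 i; apply/eqP.
  by rewrite -normr_eq0 eq_le normr_ge0 andbT -x0 ler_coord_euclidean_norm.
rewrite (lebesgue_Rd_box (fun=> [set 0]))// (bigD1 (Ordinal d0))//=.
by rewrite lebesgue_measure_set1 mul0e.
Qed.

(** The norm is Borel on tuples, and Borel sets are Caratheodory measurable. *)
Lemma measurable_euclidean_norm :
  measurable_fun setT (euclidean_norm : Rd R d -> R).
Proof.
have mf : measurable_fun setT
    (fun x : d.-tuple R => Num.sqrt (\sum_(i < d) tnth x i ^+ 2)).
  apply: (measurableT_comp (f := @Num.sqrt R)).
    by apply: continuous_measurable_fun; exact: sqrt_continuous.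
  apply: measurable_sum => i.
  by apply: measurable_funX; exact: measurable_tnth.
move=> _ Y mY; have := mf measurableT Y mY.
exact: caratheodory_measurable_mu_ext.
Qed.

Lemma weight_power_weight (gamma : R) : (0 < d)%N ->
  weight (power_weight gamma : Rd R d -> \bar R).
Proof.
move=> d0; split.
  apply/measurable_EFinP.
  apply: (measurableT_comp (f := fun r : R => r `^ gamma)).
    exact: measurable_powR.
  exact: measurable_euclidean_norm.
exists [set x | euclidean_norm x = 0]; split.
- rewrite -[X in measurable X]setTI.
  rewrite (_ : [set x | _] = euclidean_norm @^-1` [set 0%R]) //.
  exact: measurable_euclidean_norm.
- exact: euclidean_norm_origin_null.
- move=> x /=; apply: contra_notP => /eqP x0.
  rewrite /power_weight ltry andbT lte_fin powR_gt0//.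
  by rewrite lt_neqAle eq_sym x0 euclidean_norm_ge0.
Qed.

End euclidean_space.

(** * Upper bounds for powers of the norm on cubes *)

Section power_functions.
Context {R : realType} {d : nat} (d_gt0 : (0 < d)%N).
Implicit Types (x : Rd R d) (c : d.-tuple R) (l a alpha K M : R) (b : \bar R)
  (f : Rd R d -> \bar R).

Let d_neq0 : d%:R != 0 :> R. Proof. by rewrite pnatr_eq0 -lt0n. Qed.
Let dR_gt0 : 0 < d%:R :> R. Proof. by rewrite ltr0n. Qed.

Lemma power_admissibleP a b alpha : lorentz_admissible a (alpha / d%:R) b <->
  - (d%:R / a) < alpha \/ alpha = - (d%:R / a) /\ b = +oo%E.
Proof.
rewrite /lorentz_admissible.
have -> : a^-1 + alpha / d%:R = (alpha + d%:R / a) / d%:R.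
  by rewrite mulrDl addrC mulrAC divff// mul1r.
rewrite pmulr_lgt0 ?invr_gt0// -[_ < alpha]subr_gt0 opprK.
split=> -[?|[ad ->]]; [by left|right|by left|right]; split=> //.
  by apply/eqP; move/eqP : ad; rewrite mulf_eq0 invr_eq0 (negbTE d_neq0) orbF addr_eq0.
by rewrite ad addNr mul0r.
Qed.

Definition cube c l : set (Rd R d) :=
  [set x | forall i, tnth c i <= tnth x i <= tnth c i + l].

(** Treats the weight and its inverse alike: at the origin the conventions give 0 for a nonzero
    power and [+oo] for its inverse, so only values off that null set are prescribed. *)
Definition power_off_origin alpha f : Prop := forall x,
  euclidean_norm x != 0 -> f x = (euclidean_norm x `^ alpha)%:E.

Lemma power_weight_off_origin alpha :
  power_off_origin alpha (power_weight alpha).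
Proof. by []. Qed.

Lemma power_weight_inv_off_origin alpha :
  power_off_origin (- alpha) (fun x => (power_weight alpha x)^-1%E).
Proof.
move=> x x0; rewrite /power_weight inver powR_eq0 (negbTE x0) /=.
by rewrite powRN.
Qed.

Lemma root_expn (t : R) : 0 <= t -> (t `^ d%:R^-1) ^+ d = t.
Proof. by move=> t0; rewrite -powR_mulrn ?powR_ge0// -powRrM mulVf// powRr1. Qed.

Lemma lorentz_norm_on_ge0 a b (Q : set (Rd R d)) f :
  (0 <= lorentz_norm_on a b Q f)%E.
Proof.
rewrite mule_ge0 ?poweR_ge0//; case: b => [b||//]; first exact: poweR_ge0.
apply: le_ereal_sup_tmp; eexists; first by exists 1 => //=; exact: ltr01.
by rewrite mule_ge0 ?decreasing_rearrangement_ge0// lee_fin powR_ge0.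
Qed.

Lemma mule_indic_le (A : set (Rd R d)) f x (y : \bar R) : (0 <= y)%E ->
  (A x -> (`|f x| <= y)%E) -> (`|f x * (\1_A x)%:E| <= y)%E.
Proof.
move=> y0 fy; rewrite indicE; have [/set_mem/fy|_] := boolP (x \in A).
  by rewrite mule1.
by rewrite mule0 abse0.
Qed.

(** Taking [T = l ^ d], the measure of the cube, the normalization cancels [T ^ (1/a)] and leaves
    [T ^ e]. *)
Lemma lorentz_norm_on_upper a e b : 0 < a -> (1 <= b)%E ->
  lorentz_admissible a e b ->
  exists2 C, 0 <= C & forall K c l f, 0 <= K -> 0 < l ->
    (forall t, 0 < t -> (decreasing_rearrangement
      (fun x => f x * (\1_(cube c l) x)%:E)%E t <= (K * t `^ e)%:E)%E) ->
    (lorentz_norm_on a b (cube c l) f <= (C * K * (l ^+ d) `^ e)%:E)%E.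
Proof.
move=> a0 b1 /(lorentz_norm_upper (d := d) _ _ _ a0 b1)[C C0 CP].
exists C => // K c l f K0 l0 fK.
have ld0 : 0 < l ^+ d by rewrite exprn_gt0.
rewrite /lorentz_norm_on lebesgue_Rd_cube// poweR_EFin.
apply: le_trans (lee_wpmul2l _ (CP K (l ^+ d) _ K0 ld0 _ _)) _.
- by rewrite lee_fin powR_ge0.
- by move=> t t0 _; exact: fK.
(* The localized function vanishes off the cube, so its level set at 0 has measure at most
   [l ^ d]. *)
- move=> t lt; apply: decreasing_rearrangement_le => //.
  apply: (@le_trans _ _ (l ^+ d)%:E); last by rewrite lee_fin.
  rewrite -(lebesgue_Rd_cube c)//; apply: lebesgue_Rd_subset => x /=.
  rewrite ltNge => /negP; apply: contra_notP => cx.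
  by apply: mule_indic_le => // /cx.
- rewrite -EFinM lee_fin mulrCA -powRD_gt0//.
  by rewrite addrA addNr add0r.
Qed.

(** The case [e = 0], admissible as [1/a > 0]. The bound may fail at the origin, a null set
    invisible to the rearrangement. *)
Lemma bounded_lorentz_norm_on a b : 0 < a -> (1 <= b)%E ->
  exists2 C, 0 <= C & forall M c l f, 0 <= M -> 0 < l ->
    (forall x, cube c l x -> euclidean_norm x != 0 -> (`|f x| <= M%:E)%E) ->
    (lorentz_norm_on a b (cube c l) f <= (C * M)%:E)%E.
Proof.
move=> a0 b1.
have adm : lorentz_admissible a 0 b by left; rewrite addr0 invr_gt0.
have [C C0 CP] := lorentz_norm_on_upper a 0 b a0 b1 adm.
exists C => // M c l f M0 l0 fM.
rewrite -[M in leRHS]mulr1 mulrA -(powRr0 (l ^+ d)); apply: CP => // t t0.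
rewrite powRr0 mulr1; apply: decreasing_rearrangement_le => //.
apply: (@le_trans _ _ 0%E); last by rewrite lee_fin ltW.
rewrite -(euclidean_norm_origin_null d_gt0); apply: lebesgue_Rd_subset => x /=.
rewrite ltNge => /negP; apply: contra_notP => /eqP x0.
by apply: mule_indic_le => // cx; exact: fM.
Qed.

(** Wherever the cube lies, [|f|] exceeds [rho ^ alpha] only inside the box of half-side [rho] about
    the origin. Choosing [rho] so that this box has measure [t] bounds the rearrangement at [t] by
    [rho ^ alpha]. *)
Lemma singular_lorentz_norm_on a b alpha : 0 < a -> (1 <= b)%E ->
  alpha <= 0 -> lorentz_admissible a (alpha / d%:R) b ->
  exists2 C, 0 <= C & forall c l f, 0 < l -> power_off_origin alpha f ->
    (lorentz_norm_on a b (cube c l) f <= (C * l `^ alpha)%:E)%E.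
Proof.
move=> a0 b1 alpha0 /(lorentz_norm_on_upper _ _ _ a0 b1)[C C0 CP].
exists (C * 2 `^ (- alpha)); first by rewrite mulr_ge0// powR_ge0.
move=> c l f l0 fP.
have -> : l `^ alpha = (l ^+ d) `^ (alpha / d%:R).
  by rewrite -powR_mulrn ?(ltW l0)// -powRrM mulrCA divff// mulr1.
apply: CP; rewrite ?powR_ge0// => t t0.
pose rho := t `^ d%:R^-1 / 2.
have rho0 : 0 < rho by rewrite divr_gt0// powR_gt0.
have -> : 2 `^ (- alpha) * t `^ (alpha / d%:R) = rho `^ alpha.
  rewrite /rho powRM ?powR_ge0 ?invr_ge0// -powRrM mulrC (mulrC _^-1).
  by congr (_ * _); rewrite -powR_inv1// -powRrM mulN1r.
apply: decreasing_rearrangement_le; first exact: powR_ge0.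
rewrite -[in leRHS](@root_expn t) ?(ltW t0)//.
rewrite -(@lebesgue_Rd_itv_box _ _ true false (fun=> - rho) (fun=> rho)); last 2 first.
- by rewrite powR_gt0.
- by move=> _; rewrite /rho; lra.
apply: lebesgue_Rd_subset => x /=.
rewrite ltNge => /negP; apply: contra_notP => /existsNP[i xi].
apply: mule_indic_le => [|_]; first by rewrite lee_fin powR_ge0.
have rx : rho < euclidean_norm x.
  apply: lt_le_trans (ler_coord_euclidean_norm x i).
  rewrite ltNge; apply/negP => h; apply: xi.
  by rewrite in_itv/= -ler_norml.
have x0 : 0 < euclidean_norm x by exact: lt_trans rx.
rewrite fP ?gt_eqF// gee0_abs ?lee_fin ?powR_ge0//.
rewrite -[alpha]opprK !(powRN _ (- alpha)) lef_pV2 ?posrE ?powR_gt0//.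
by rewrite ge0_ler_powR ?oppr_ge0 ?nnegrE ?(ltW rho0) ?(ltW x0) ?(ltW rx).
Qed.

(* Either the cube lies within distance comparable to its side l of the origin
   and rho = l works, or it is far from the origin and |x| is comparable to rho
   throughout. *)
Lemma cube_scale c l : 0 < l -> exists2 rho, 0 < rho &
  (forall x, cube c l x -> euclidean_norm x <= 3 * d%:R * rho) /\
  (rho = l \/ forall x, cube c l x -> rho <= euclidean_norm x).
Proof.
move=> l0.
pose i := [arg max_(j > Ordinal d_gt0) `|tnth c j|]%O.
have ci j : `|tnth c j| <= `|tnth c i|.
  by rewrite /i; case: arg_maxP => // k _; apply.
have cube_norm x j : cube c l x -> `|tnth x j - tnth c j| <= l.
  by move=> /(_ j)/andP[? ?]; rewrite ger0_norm; lra.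
(* In the near case all coordinates of [x] are at most [3 * l]. In the far case
   [rho = |c_i| / 2 > l], so every [|x_j| <= 2 * rho + l <= 3 * rho], while
   [|x_i| >= 2 * rho - l >= rho]. *)
have [cl|lc] := leP `|tnth c i| (2 * l).
- exists l => //; split; last by left.
  move=> x cx; rewrite (mulrC 3) -mulrA; apply: euclidean_norm_le.
    by rewrite mulr_ge0// ltW.
  move=> j; rewrite -(subrK (tnth c j) (tnth x j)).
  apply: le_trans (ler_normD _ _) _.
  by have := cube_norm x j cx; have := ci j; lra.
- exists (`|tnth c i| / 2); first by rewrite divr_gt0//; lra.
  split; last first.
    right=> x cx; apply: le_trans (ler_coord_euclidean_norm x i).
    have := cube_norm x i cx; have := ler_dist_dist (tnth x i) (tnth c i).
    by have := ler_distD (tnth x i) 0 (tnth c i); rewrite !sub0r !normrN; lra.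
  move=> x cx; rewrite (mulrC 3) -mulrA; apply: euclidean_norm_le.
    by rewrite mulr_ge0.
  move=> j; rewrite -(subrK (tnth c j) (tnth x j)).
  apply: le_trans (ler_normD _ _) _.
  by have := cube_norm x j cx; have := ci j; lra.
Qed.

(** At the scale [rho] of the cube, [f] contributes [rho ^ alpha] and [g], through its supremum,
    [rho ^ (- alpha)]. Keeping [f] and [g] abstract lets either the weight or its inverse be the
    singular factor. *)
Lemma power_lorentz_product_bounded a b a' b' alpha :
  0 < a -> (1 <= b)%E -> 0 < a' -> (1 <= b')%E -> alpha <= 0 ->
  lorentz_admissible a (alpha / d%:R) b ->
  exists2 C, 0 <= C & forall c l f g, 0 < l ->
    power_off_origin alpha f -> power_off_origin (- alpha) g ->
    (lorentz_norm_on a b (cube c l) f * lorentz_norm_on a' b' (cube c l) g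
     <= C%:E)%E.
Proof.
move=> a0 b1 a'0 b'1 alpha0 adm.
have [C1 C10 C1P] := singular_lorentz_norm_on _ _ _ a0 b1 alpha0 adm.
have [C2 C20 C2P] := bounded_lorentz_norm_on _ _ a0 b1.
have [C3 C30 C3P] := bounded_lorentz_norm_on _ _ a'0 b'1.
(* [C1] covers cubes near the origin and [C2] those far away; [3 * d] comes from the bound on [|x|]
   in [cube_scale]. *)
exists ((C1 + C2) * (C3 * (3 * d%:R) `^ (- alpha))).
  by rewrite !mulr_ge0 ?addr_ge0 ?powR_ge0.
move=> c l f g l0 fP gP.
have [rho rho0 [xrho rhoP]] := cube_scale c l l0.
have norm_gt0 x : euclidean_norm x != 0 -> 0 < euclidean_norm x.
  by move=> x0; rewrite lt_neqAle eq_sym x0 euclidean_norm_ge0.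
have fle : (lorentz_norm_on a b (cube c l) f <=
    ((C1 + C2) * rho `^ alpha)%:E)%E.
  case: rhoP => [->|rhox].
    apply: le_trans (C1P _ _ _ l0 fP) _.
    by rewrite lee_fin ler_wpM2r ?powR_ge0// lerDl.
  apply: (@le_trans _ _ (C2 * rho `^ alpha)%:E); last first.
    by rewrite lee_fin ler_wpM2r ?powR_ge0// lerDr.
  apply: C2P; rewrite ?powR_ge0// => x cx x0.
  rewrite fP// gee0_abs ?lee_fin ?powR_ge0//.
  rewrite -[alpha]opprK !(powRN _ (- alpha)) lef_pV2 ?posrE ?powR_gt0 ?norm_gt0//.
  by rewrite ge0_ler_powR ?oppr_ge0 ?nnegrE ?(ltW rho0) ?euclidean_norm_ge0 ?rhox.
have gle : (lorentz_norm_on a' b' (cube c l) g <=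
    (C3 * (3 * d%:R * rho) `^ (- alpha))%:E)%E.
  apply: C3P; rewrite ?powR_ge0// => x cx x0.
  rewrite gP// gee0_abs ?lee_fin ?powR_ge0//.
  by rewrite ge0_ler_powR ?oppr_ge0 ?nnegrE ?euclidean_norm_ge0 ?xrho// !mulr_ge0// ltW.
apply: le_trans (lee_pmul (lorentz_norm_on_ge0 _ _ _ _) (lorentz_norm_on_ge0 _ _ _ _) fle gle) _.
rewrite -EFinM lee_fin (@powRM _ (3 * d%:R)) ?mulr_ge0 ?(ltW rho0)//.
rewrite [leLHS](_ : _ = (C1 + C2) * (C3 * (3 * d%:R) `^ (- alpha)) *
  (rho `^ alpha * rho `^ (- alpha))); last by ring.
by rewrite -powRD_gt0// subrr powRr0 mulr1.
Qed.

(** * Lower bounds on a cube with a vertex at the origin *)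

Local Notation Q02 := (cube [tuple 0%R | _ < d] 2%R).

(** For [alpha >= 0] the function is at least 1 on []1, 2]^d], of measure [1 > t]. For [alpha < 0]
    it is at least [(d * u) ^ alpha] on []0, u]^d]. Side 2 makes room for both boxes, and their open
    left ends avoid the origin. *)
Lemma power_rearrangement_lower alpha f : power_off_origin alpha f ->
  exists2 c, 0 < c & forall t, 0 < t -> t < 1 ->
    ((c * t `^ (Num.min alpha 0 / d%:R))%:E <= decreasing_rearrangement
      (fun x => f x * (\1_Q02 x)%:E)%E t)%E.
Proof.
move=> fP.
have f_cube x l' (u v : R) : 0 <= u -> v <= 2 ->
    (forall i, [set` `]u, v]] (tnth x i)) ->
    (l'%:E < (euclidean_norm x `^ alpha)%:E)%E ->
    (l'%:E < `|f x * (\1_Q02 x)%:E|)%E.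
  move=> u0 v2 xuv l'x.
  have x0 : euclidean_norm x != 0.
    rewrite gt_eqF//; apply: lt_le_trans (ler_coord_euclidean_norm x (Ordinal d_gt0)).
    by have := xuv (Ordinal d_gt0); rewrite /= in_itv/= normr_gt0; lra.
  rewrite indicE mem_set ?mule1 ?fP// ?gee0_abs ?lee_fin ?powR_ge0//.
  by move=> i; have := xuv i; rewrite /= in_itv/= tnth_mktuple; lra.
have [alpha0|alpha0] := leP 0 alpha.
  exists 1 => // t t0 t1; rewrite mul0r powRr0 mulr1.
  apply: decreasing_rearrangement_ge => l' l'0 l'1.
  apply: (@lt_le_trans _ _ 1%E); first by rewrite lte_fin.
  have := @lebesgue_Rd_itv_box R d false false (fun=> 1) (fun=> 2) 1 ltr01.
  rewrite expr1n => <-; last by move=> _; lra.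
  apply: lebesgue_Rd_subset => x /= x12; apply: (f_cube x l' 1 2) => //.
  rewrite lte_fin (lt_le_trans l'1)// -[1](powRr0 (euclidean_norm x)) ler_powR//.
  apply: le_trans (ler_coord_euclidean_norm x (Ordinal d_gt0)).
  by have := x12 (Ordinal d_gt0); rewrite in_itv/=; have := ler_norm (tnth x (Ordinal d_gt0)); lra.
exists (d%:R `^ alpha * 2 `^ (alpha / d%:R)).
  by rewrite mulr_gt0// powR_gt0.
move=> t t0 t1; apply: decreasing_rearrangement_ge => l' l'0 l't.
(* The box of side [u] has measure [2 * t]: the factor 2 provides the strict excess over [t] and the
   [2 ^ (alpha / d)] in the constant. *)
pose u := (2 * t) `^ d%:R^-1.
have t20 : 0 < 2 * t by rewrite mulr_gt0.
have u0 : 0 < u by rewrite powR_gt0.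
have u2 : u <= 2.
  apply: (@le_trans _ _ (2 `^ d%:R^-1)).
    by rewrite ge0_ler_powR ?nnegrE ?invr_ge0//; lra.
  by rewrite -[leRHS]powRr1// ler_powR ?ler1n// invf_le1// ler1n.
apply: (@lt_le_trans _ _ (u ^+ d)%:E).
  by rewrite lte_fin root_expn ?(ltW t20)//; lra.
rewrite -(@lebesgue_Rd_itv_box _ _ false false (fun=> 0) (fun=> u))//; last first.
  by move=> _; rewrite add0r.
apply: lebesgue_Rd_subset => x /= x0u; apply: (f_cube x l' 0 u) => //.
rewrite lte_fin (lt_le_trans l't)//.
have x0 : 0 < euclidean_norm x.
  apply: lt_le_trans (ler_coord_euclidean_norm x (Ordinal d_gt0)).
  by have := x0u (Ordinal d_gt0); rewrite in_itv/= normr_gt0; lra.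
rewrite -mulrA -powRM ?(ltW t0)// mulrC (mulrC alpha) powRrM -/u -powRM ?(ltW u0)//.
rewrite -[alpha]opprK !(powRN _ (- alpha)) lef_pV2 ?posrE ?powR_gt0 ?mulr_gt0//.
rewrite ge0_ler_powR ?oppr_ge0 ?nnegrE ?(ltW alpha0) ?(ltW x0) ?mulr_ge0 ?(ltW u0)//.
rewrite mulrC; apply: euclidean_norm_le; first exact: ltW.
by move=> i; have := x0u i; rewrite in_itv/= ler_norml; lra.
Qed.

Lemma power_lorentz_norm_on_lower a b alpha f : 0 < a -> (1 <= b)%E ->
  power_off_origin alpha f ->
  let N := lorentz_norm_on a b Q02 f in
  (0 < N)%E /\ ((N < +oo)%E ->
    - (d%:R / a) < alpha \/ alpha = - (d%:R / a) /\ b = +oo%E).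
Proof.
move=> a0 b1 fP /=.
have [c c0 cP] := power_rearrangement_lower _ _ fP.
have [N0 Nadm] := lorentz_norm_lower _ _ _ _ _ a0 b1 c0 cP.
have Q0 : (0 < lebesgue_Rd R d Q02 `^ (- a^-1))%E.
  by rewrite lebesgue_Rd_cube// poweR_EFin lte_fin powR_gt0.
rewrite /lorentz_norm_on; split; first exact: mule_gt0.
move=> Noo.
(* A nonnegative exponent satisfies the criterion outright, since [- (d / a) < 0]. *)
have [alpha0|alpha0] := leP 0 alpha.
  by left; rewrite (lt_le_trans _ alpha0)// oppr_lt0 divr_gt0.
have {}/Nadm : (lorentz_norm a b
    (fun x => f x * (\1_Q02 x)%:E)%E < +oo)%E.
  rewrite ltey; apply/eqP => Ny.
  by move: Noo; rewrite Ny gt0_muley// ltxx.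
by rewrite min_l ?(ltW alpha0)// => /power_admissibleP.
Qed.

End power_functions.

(** * The characterization of power weights *)

Theorem theorem3p13 (R : realType) (d : nat) (p q gamma : R) (r s : \bar R)
    (hd : (0 < d)%N) (hp : 1 < p) (hpq : p <= q)
    (hr : (1 <= r)%E) (hs : (1 <= s)%E) :
  A_class p r q s (power_weight gamma : Rd R d -> \bar R) <->
  (- (d%:R / q) < gamma \/ gamma = - (d%:R / q) /\ s = +oo%E) /\
  (gamma < d%:R / fine (hoelder_conjugate p%:E) \/
   gamma = d%:R / fine (hoelder_conjugate p%:E) /\ r = 1%E).
Proof.
have q0 : 0 < q by rewrite (lt_le_trans _ hpq)// (lt_trans ltr01).
have p'0 : 0 < fine (hoelder_conjugate p%:E).
  rewrite /hoelder_conjugate/= eqe (gt_eqF (lt_trans ltr01 hp)) -EFinD inver.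
  by rewrite subr_eq0 (gt_eqF hp) -EFinM divr_gt0 ?subr_gt0// (lt_trans ltr01).
set p' := fine _ in p'0 *.
have r'1 : (1 <= hoelder_conjugate r)%E by exact: hoelder_conj_ge1.
(* Translates the endpoint case for the inverse weight into the [r = 1] of condition (b). *)
have r'y : hoelder_conjugate r = +oo%E <-> r = 1%E.
  by split=> [/hoelder_conjugate_eqy//|->]; exact: hoelder_conjugate1.
have wP := @power_weight_off_origin R d gamma.
have wVP := @power_weight_inv_off_origin R d gamma.
split=> [[_ Afin]|[condq condp]].
- have [N1gt0 N1] := power_lorentz_norm_on_lower hd _ _ _ _ q0 hs wP.
  have [N2gt0 N2] := power_lorentz_norm_on_lower hd _ _ _ _ p'0 r'1 wVP.
  move: N1gt0 N1 N2gt0 N2; set Q := cube _ _.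
  set n1 := lorentz_norm_on q s Q _; set n2 := lorentz_norm_on p' _ Q _.
  (* Both norms on the test cube are positive, so an infinite one would make the product
     infinite. *)
  move=> n1_gt0 n1P n2_gt0 n2P.
  have n12 : (n1 * n2 < +oo)%E.
    apply: le_lt_trans Afin; apply: ereal_sup_ubound; exists Q => //.
    by exists [tuple 0 | _ < d], 2.
  split.
    apply: n1P; rewrite ltey; apply/eqP => ny.
    by move: n12; rewrite ny gt0_mulye// ltxx.
  have n2_lty : (n2 < +oo)%E.
    rewrite ltey; apply/eqP => ny.
    by move: n12; rewrite ny gt0_muley// ltxx.
  case: (n2P n2_lty) => [|[/oppr_inj -> /r'y ->]]; last by right.
  by rewrite ltrN2; left.
- split; first exact: weight_power_weight.
  suff [C C0 CP] : exists2 C, 0 <= C & forall (c : d.-tuple R) l, 0 < l ->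
      (lorentz_norm_on q s (cube c l) (power_weight gamma) *
       lorentz_norm_on p' (hoelder_conjugate r) (cube c l)
         (fun x => (power_weight gamma x)^-1) <= C%:E)%E.
    apply: (@le_lt_trans _ _ C%:E); last exact: ltry.
    apply: ge_ereal_sup => _ [Q [c [l [l0 ->]]] <-].
    exact: CP.
  (* The sign of [gamma] decides which factor is singular: the weight, governed by (a), or its
     inverse with exponent [- gamma], governed by (b). *)
  have [gamma0|gamma0] := leP gamma 0.
    have /(power_admissibleP hd) adm := condq.
    have [C C0 CP] := power_lorentz_product_bounded hd _ _ _ _ _
      q0 hs p'0 r'1 gamma0 adm.
    by exists C => // c l l0; exact: CP.
  have adm : lorentz_admissible p' (- gamma / d%:R) (hoelder_conjugate r).
    apply/(power_admissibleP hd); rewrite ltrN2.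
    by case: condp => [|[-> /r'y]]; [left|right].
  have Ngamma0 : - gamma <= 0 by rewrite oppr_le0 ltW.
  have [C C0 CP] := power_lorentz_product_bounded hd _ _ _ _ _
    p'0 r'1 q0 hs Ngamma0 adm.
  exists C => // c l l0; rewrite muleC.
  by apply: CP; rewrite ?opprK.
Qed.
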